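(* Consider invertible matrices $\hat R\in\mathrm{End}(\mathbb C^n\otimes\mathbb C^n)$ of the form (no summation) $$\hat R^{ij}_{kl}=(1-\beta_{ji})\delta^i_l\delta^j_k+\beta_{ij}\delta^i_k\delta^j_l-\beta_{ij}\delta^i_k\delta^i_l+\beta_{ji}\delta^j_k\delta^j_l,\qquad \beta_{ii}=0 .\qquad ( * )$$ The non-unitary strict rime solutions of the Yang--Baxter equation of the form $( * )$ with a parameter $\beta=\beta_{ij}+\beta_{ji}\neq0$ (the same for all $i\ne j$) are parameterized by a point $\phi=(\phi_1:\phi_2:\dots:\phi_n)$ of the projective space $\mathbb P\mathbb C^n$ such that $\phi_i\neq0$ for all $i$ and $\phi_i\neq\phi_j$ for all $i$ and $j$, $i\ne j$. These solutions are given by $$\beta_{ij}=\frac{\beta\,\phi_i}{\phi_i-\phi_j}\qquad(i\neq j).$$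
   Context: For the standard basis $e_1,\dots,e_n$ of $\mathbb C^n$, entries are defined by $\hat R(e_k\otimes e_l)=\sum_{i,j}\hat R^{ij}_{kl}\,e_i\otimes e_j$. The Yang--Baxter equation is $(\hat R\otimes 1)(1\otimes\hat R)(\hat R\otimes 1)=(1\otimes\hat R)(\hat R\otimes 1)(1\otimes\hat R)$. A matrix $\hat R$ is rime if $\hat R^{ij}_{kl}\neq0$ implies $\{k,l\}\subset\{i,j\}$; such a matrix has the form $\hat R^{ij}_{kl}=\alpha_{ij}\delta^i_l\delta^j_k+\beta_{ij}\delta^i_k\delta^j_l+\gamma_{ij}\delta^i_k\delta^i_l+\gamma'_{ij}\delta^j_k\delta^j_l$ (no summation, $\beta_{ii}=\gamma_{ii}=\gamma'_{ii}=0$). It is strict rime if $\alpha_{ij}\gamma_{ij}\neq0$ for all $i\neq j$. In $( * )$ one has $\alpha_{ij}=1-\beta_{ji}$ and $\gamma_{ij}=-\beta_{ij}$. Unitary means that $\hat R^2$ is the identity, which corresponds to $\beta=0$.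
   Formalization: Points with β=1 (R not invertible) or φ_i=(1−β)φ_j for some i≠j (not strict rime, e.g. n=2, β=2, φ=(1:−1)) do not give solutions of the stated class; the formal converse is an equivalence with these excluded, and n≥2 is assumed so that β is defined. *)

(* Defs.v *)
From HB Require Import structures.
From mathcomp Require Import all_boot all_order all_algebra.
From mathcomp Require Import complex mxtens.
From mathcomp Require Import reals.

Set Implicit Arguments.
Unset Strict Implicit.
Unset Printing Implicit Defensive.

Import GRing.Theory.
Local Open Scope ring_scope.

(* Matrices act on column vectors, and e_i (x) e_j is the
   basis vector of index mxtens_index (i, j), so that the coefficient R^{ij}_{kl}
   of e_i (x) e_j in R (e_k (x) e_l) is the entry of R in row (i, j) and column
   (k, l), and composition of operators is the matrix product. *)

Section RimeMatrices.

Variables (F : fieldType) (n : nat).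

Implicit Types (Rh : 'M[F]_(n * n)) (b : 'M[F]_n).

Definition entry Rh (i j k l : 'I_n) : F :=
  Rh (mxtens_index (i, j)) (mxtens_index (k, l)).

Definition of_entries (f : 'I_n -> 'I_n -> 'I_n -> 'I_n -> F) : 'M[F]_(n * n) :=
  \matrix_(r, c) f (mxtens_unindex r).1 (mxtens_unindex r).2
                   (mxtens_unindex c).1 (mxtens_unindex c).2.

Definition delta (i j : 'I_n) : F := (i == j)%:R.

(* The cast identifies the index set of V (x) (V (x) V), on which 1 (x) R is
   defined, with that of (V (x) V) (x) V; it preserves the numerical value of
   indices, which is the canonical identification because
   i * (n * n) + (j * n + k) = (i * n + j) * n + k. *)
Definition R12 Rh : 'M[F]_(n * n * n) := Rh *t (1%:M : 'M[F]_n).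

Definition R23 Rh : 'M[F]_(n * n * n) :=
  castmx (mulnA n n n, mulnA n n n) ((1%:M : 'M[F]_n) *t Rh).

Definition yang_baxter Rh : Prop :=
  R12 Rh *m R23 Rh *m R12 Rh = R23 Rh *m R12 Rh *m R23 Rh.

Definition unitary Rh : Prop := Rh *m Rh = 1%:M.

Definition rime Rh : Prop :=
  forall i j k l, entry Rh i j k l != 0 -> [set k; l] \subset [set i; j].

Definition rime_mx (al be ga ga' : 'M[F]_n) : 'M[F]_(n * n) :=
  of_entries (fun i j k l =>
      al i j * delta i l * delta j k + be i j * delta i k * delta j l
    + ga i j * delta i k * delta i l + ga' i j * delta j k * delta j l).

(* The normalization of the diagonals makes the four coefficient families of a
   rime matrix unique, so the existential refers to "the" al and ga. *)
Definition strict_rime Rh : Prop :=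
  rime Rh /\
  exists al be ga ga' : 'M[F]_n,
    [/\ forall i, [/\ be i i = 0, ga i i = 0 & ga' i i = 0],
        Rh = rime_mx al be ga ga'
      & forall i j, i != j -> al i j * ga i j != 0].

Definition beta_mx b : 'M[F]_(n * n) :=
  of_entries (fun i j k l =>
      (1 - b j i) * delta i l * delta j k + b i j * delta i k * delta j l
    - b i j * delta i k * delta i l + b j i * delta j k * delta j l).

Definition beta_form (beta : F) Rh : Prop :=
  exists b,
    [/\ forall i, b i i = 0,
        forall i j, i != j -> b i j + b j i = beta
      & Rh = beta_mx b].

Definition nonunitary_strict_rime_solution (beta : F) Rh : Prop :=
  [/\ Rh \in unitmx, beta_form beta Rh, ~ unitary Rh, strict_rime Rh
    & yang_baxter Rh].

(* Points of the projective space of F^n are lines through the origin. *)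
Definition proj_space := {L : {vspace 'rV[F]_n} | \dim L == 1%N}.

Definition homogeneous_coords (P : proj_space) (phi : 'rV[F]_n) : Prop :=
  phi != 0 /\ phi \in sval P.

(* The conditions on a point are invariant under rescaling, and are required of
   each of its (nonempty set of) systems of homogeneous coordinates. *)
Definition admissible (P : proj_space) : Prop :=
  forall phi, homogeneous_coords P phi ->
    (forall i, phi 0 i != 0) /\ (forall i j, i != j -> phi 0 i != phi 0 j).

Definition beta_of (beta : F) (phi : 'rV[F]_n) : 'M[F]_n :=
  \matrix_(i, j) if i == j then 0 else beta * phi 0 i / (phi 0 i - phi 0 j).

Definition given_by (beta : F) (P : proj_space) Rh : Prop :=
  forall phi, homogeneous_coords P phi -> Rh = beta_mx (beta_of beta phi).

(* For the matrix given by P, alpha_ij = 0 exactly when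
   phi_i = (1 - beta) phi_j. *)
Definition nonvanishing_alpha (beta : F) (P : proj_space) : Prop :=
  forall phi, homogeneous_coords P phi ->
    forall i j, i != j -> phi 0 i != (1 - beta) * phi 0 j.

End RimeMatrices.

(* Main.v *)
Require Import Defs.
From HB Require Import structures.
From mathcomp Require Import all_boot all_order all_algebra.
From mathcomp Require Import complex mxtens.
From mathcomp Require Import reals.
From mathcomp Require Import ring.

Set Implicit Arguments.
Unset Strict Implicit.
Unset Printing Implicit Defensive.

Import GRing.Theory.
Local Open Scope ring_scope.

(** Write a tensor of V (x) V as a function w of two indices.  A matrix of the
    form considered here sends it to
      (i, j) |-> (1 - b_ji) w(j, i) + b_ij w(i, j) - b_ij w(i, i) + b_ji w(j, j),
    so its value at (i, j) only involves the values of w at words in the letters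
    i and j.  Hence the Yang-Baxter equation can be tested one triple (i, j, k)
    at a time, on words in the letters i, j, k ([yang_baxter_beta_mxP]).

    From a solution to a point.  Comparing the coefficients of w(j, i, k) in the
    value at (i, j, k), for distinct i, j, k, and cancelling alpha_ij = 1 - b_ji,
    which is where strictness enters, gives
      b_ij b_jk = (b_jk - b_ji) b_ik                      ([braid_relation]).
    If moreover b_ij + b_ji = beta, this is equivalent (beta being nonzero) to
    the cyclic identity b_ij b_jk b_ki + b_ik b_kj b_ji = 0, which says that the
    ratios - b_ji / b_ij multiply consistently, like quotients phi_j / phi_i.
    So one fixes an index i0, sets phi_i0 = 1 and phi_i = - b_(i i0) / b_(i0 i);
    then b_ji phi_i = - b_ij phi_j for all distinct i and j, and with
    b_ij + b_ji = beta this is b_ij (phi_i - phi_j) = beta phi_i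
    ([coords_of_relation]).  Conversely the off-diagonal b_ij determine phi up
    to a scalar ([beta_of_inj]).

    From a point to a solution.  For b_ij = beta phi_i / (phi_i - phi_j) and
    w(i, j) = f(phi_i, phi_j), the operator is
      f(x, y) |-> f(y, x) + beta (x (f(x, y) - f(x, x)) + y (f(y, x) - f(y, y)))
                            / (x - y),
    and its braid relation is a rational identity in three variables; index
    triples with a repetition need only b_ii = 0 and b_ij + b_ji = beta
    ([yang_baxter_beta_of]).

    The other properties follow from the Hecke relation
    R^2 = beta R + (1 - beta) ([beta_mx_hecke]), valid as soon as
    b_ij + b_ji = beta: it gives an inverse of R when beta != 1; and if
    R^2 = 1, or if beta = 1 and R is invertible, it forces R = 1, against the
    nonzero entries - b_ij.  Finally all the b_ij are nonzero for a point with
    nonzero coordinates, so strictness means that no alpha_ij vanishes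
    ([strict_rime_beta_mx]).  The argument works over any field. *)

(** * Action on tensors with two and three indices *)

Section Tensors.

Variables (F : fieldType) (n : nat).
Implicit Types (Rh : 'M[F]_(n * n)) (b : 'M[F]_n) (i j k l : 'I_n).

Lemma sum_mxtens_index p q (g : 'I_(p * q) -> F) :
  \sum_r g r = \sum_i \sum_j g (mxtens_index (i, j)).
Proof.
rewrite pair_bigA (reindex (@mxtens_index p q)) /=.
  by apply: eq_bigr => -[i j].
by exists (@mxtens_unindex p q) => r _; rewrite (mxtens_indexK, mxtens_unindexK).
Qed.

Lemma sum_delta i (g : 'I_n -> F) : \sum_k delta F i k * g k = g i.
Proof.
rewrite (bigD1 i) //= big1 ?addr0 => [|k ki]; rewrite /delta ?eqxx ?mul1r //.
by rewrite eq_sym (negbTE ki) mul0r.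
Qed.

Lemma sum_delta2 i j (w : 'I_n -> 'I_n -> F) :
  \sum_k \sum_l delta F i k * delta F j l * w k l = w i j.
Proof.
rewrite -(sum_delta i (fun k => w k j)); apply: eq_bigr => k _.
rewrite -[in RHS](sum_delta j (w k)) mulr_sumr.
by apply: eq_bigr => l _; rewrite mulrA.
Qed.

Lemma deltaxx i : delta F i i = 1.
Proof. by rewrite /delta eqxx. Qed.

Lemma delta_neq i j : i != j -> delta F i j = 0.
Proof. by rewrite /delta => /negbTE ->. Qed.

(** The action of [beta_mx b] on the coordinates of a tensor of V (x) V
    ([mulmx_beta_mx]). *)
Definition beta_act b (w : 'I_n -> 'I_n -> F) i j : F :=
  (1 - b j i) * w j i + b i j * w i j - b i j * w i i + b j i * w j j.

Definition beta_act12 b (w : 'I_n -> 'I_n -> 'I_n -> F) i j k : F :=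
  beta_act b (fun x y => w x y k) i j.

Definition beta_act23 b (w : 'I_n -> 'I_n -> 'I_n -> F) i j k : F :=
  beta_act b (w i) j k.

Lemma entry_of_entries (f : 'I_n -> 'I_n -> 'I_n -> 'I_n -> F) i j k l :
  entry (of_entries f) i j k l = f i j k l.
Proof. by rewrite /entry mxE !mxtens_indexK. Qed.

Lemma entry_inj Rh Rh' :
  (forall i j k l, entry Rh i j k l = entry Rh' i j k l) -> Rh = Rh'.
Proof.
by move=> e; apply/matrixP => r c; case: (mxtens_indexP r) => i j;
   case: (mxtens_indexP c) => k l; apply: e.
Qed.

Lemma sum_entry_beta_mx b (w : 'I_n -> 'I_n -> F) i j :
  \sum_k \sum_l entry (beta_mx b) i j k l * w k l = beta_act b w i j.
Proof.
rewrite /beta_act -(sum_delta2 j i w) -(sum_delta2 i j w).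
rewrite -(sum_delta2 i i w) -(sum_delta2 j j w).
rewrite !mulr_sumr -!sumrN -!big_split; apply: eq_bigr => k _ /=.
rewrite !mulr_sumr -!sumrN -!big_split; apply: eq_bigr => l _ /=.
rewrite entry_of_entries; ring.
Qed.

Lemma mulmx_beta_mx b p (M : 'M[F]_(n * n, p)) i j c :
  (beta_mx b *m M) (mxtens_index (i, j)) c
  = beta_act b (fun k l => M (mxtens_index (k, l)) c) i j.
Proof. by rewrite mxE sum_mxtens_index -sum_entry_beta_mx. Qed.

Definition idx3 i j k : 'I_(n * n * n) :=
  mxtens_index (mxtens_index (i, j), k).

Lemma idx3P (r : 'I_(n * n * n)) : exists i j k, r = idx3 i j k.
Proof.
case: (mxtens_indexP r) => s k; case: (mxtens_indexP s) => i j.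
by exists i, j, k.
Qed.

Lemma idx3_eq i j k i' j' k' :
  (idx3 i j k == idx3 i' j' k') = [&& i == i', j == j' & k == k'].
Proof.
rewrite /idx3 !(can_eq (@mxtens_indexK _ _)) xpair_eqE.
by rewrite (can_eq (@mxtens_indexK _ _)) xpair_eqE andbA.
Qed.

(** The cast in [R23] is the reassociation of tensor products. *)
Lemma cast_idx3 i j k :
  cast_ord (esym (mulnA n n n)) (idx3 i j k)
  = mxtens_index (i, mxtens_index (j, k)).
Proof. by apply: val_inj => /=; rewrite mulnDl -mulnA addnA. Qed.

Lemma mulmx_R12 b p (M : 'M[F]_(n * n * n, p)) i j k c :
  (R12 (beta_mx b) *m M) (idx3 i j k) c
  = beta_act12 b (fun x y z => M (idx3 x y z) c) i j k.
Proof.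
rewrite mxE sum_mxtens_index sum_mxtens_index /beta_act12 -sum_entry_beta_mx.
apply: eq_bigr => x _; apply: eq_bigr => y _.
rewrite -(sum_delta k (fun z => M (idx3 x y z) c)) mulr_sumr.
apply: eq_bigr => z _.
by rewrite /R12 tensmxE [1%:M _ _]mxE mulrA.
Qed.

Lemma mulmx_R23 b p (M : 'M[F]_(n * n * n, p)) i j k c :
  (R23 (beta_mx b) *m M) (idx3 i j k) c
  = beta_act23 b (fun x y z => M (idx3 x y z) c) i j k.
Proof.
rewrite mxE sum_mxtens_index sum_mxtens_index /beta_act23 -sum_entry_beta_mx.
rewrite -[RHS](sum_delta i (fun x => \sum_y \sum_z
  entry (beta_mx b) j k y z * M (idx3 x y z) c)).
apply: eq_bigr => x _; rewrite mulr_sumr; apply: eq_bigr => y _.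
rewrite mulr_sumr; apply: eq_bigr => z _.
by rewrite castmxE /= !cast_idx3 tensmxE [1%:M _ _]mxE mulrA.
Qed.

Lemma beta_act12_ext b w w' i j k : (forall x y z, w x y z = w' x y z) ->
  beta_act12 b w i j k = beta_act12 b w' i j k.
Proof. by move=> e; rewrite /beta_act12 /beta_act !e. Qed.

Lemma beta_act23_ext b w w' i j k : (forall x y z, w x y z = w' x y z) ->
  beta_act23 b w i j k = beta_act23 b w' i j k.
Proof. by move=> e; rewrite /beta_act23 /beta_act !e. Qed.

(** Matrices are compared through their action on column vectors, where the
    Yang-Baxter equation becomes a polynomial identity in the entries of [b] and
    the coordinates at words in i, j, k. *)
Lemma yang_baxter_beta_mxP b :
  yang_baxter (beta_mx b) <->
  forall (M : 'cV[F]_(n * n * n)) i j k,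
    let w x y z := M (idx3 x y z) ord0 in
    beta_act12 b (beta_act23 b (beta_act12 b w)) i j k = beta_act23 b (beta_act12 b (beta_act23 b w)) i j k.
Proof.
have lhsE (M : 'cV[F]_(n * n * n)) i j k :
  (R12 (beta_mx b) *m (R23 (beta_mx b) *m (R12 (beta_mx b) *m M))) (idx3 i j k) ord0
  = beta_act12 b (beta_act23 b (beta_act12 b (fun x y z => M (idx3 x y z) ord0))) i j k.
  rewrite mulmx_R12; apply: beta_act12_ext => x y z; rewrite mulmx_R23.
  by apply: beta_act23_ext => *; rewrite mulmx_R12.
have rhsE (M : 'cV[F]_(n * n * n)) i j k :
  (R23 (beta_mx b) *m (R12 (beta_mx b) *m (R23 (beta_mx b) *m M))) (idx3 i j k) ord0
  = beta_act23 b (beta_act12 b (beta_act23 b (fun x y z => M (idx3 x y z) ord0))) i j k.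
  rewrite mulmx_R23; apply: beta_act23_ext => x y z; rewrite mulmx_R12.
  by apply: beta_act12_ext => *; rewrite mulmx_R23.
split=> [yb M i j k|br] /=.
  by rewrite -lhsE -rhsE !mulmxA yb.
(* The basis vectors recover the columns. *)
apply/matrixP => r c; case: (idx3P r) => i [j [k ->]].
have := br (delta_mx c ord0) i j k.
by rewrite /= -lhsE -rhsE !mulmxA -!colE ![col _ _ _ _]mxE.
Qed.

(** * Consequences of the Yang-Baxter and Hecke relations *)

(** Both sides are read off the matrix entry in row (i, j, k) and column
    (j, i, k): in either order of composition each contribution exchanges i and
    j exactly once, with the factor [1 - b j i], and otherwise keeps the letters
    in place. *)
Lemma braid_relation b i j k :
  yang_baxter (beta_mx b) -> i != j -> i != k -> j != k -> 1 - b j i != 0 ->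
  b i j * b j k = (b j k - b j i) * b i k.
Proof.
move=> /yang_baxter_beta_mxP yb ij ik jk a0; apply: (mulfI a0).
have := yb (delta_mx (idx3 j i k) ord0) i j k.
(* The test vector is the basis tensor e_j (x) e_i (x) e_k, which extracts
   the coefficient of w(j, i, k). *)
have wE x y z : (delta_mx (idx3 j i k) ord0 : 'cV[F]_(n * n * n)) (idx3 x y z) ord0
  = [&& x == j, y == i & z == k]%:R by rewrite mxE andbT idx3_eq.
rewrite /= /beta_act12 /beta_act23 /beta_act !wE !eqxx !(eq_sym j i) !(eq_sym k i) !(eq_sym k j).
rewrite !(negbTE ij) !(negbTE ik) !(negbTE jk) /= => /eqP.
rewrite -subr_eq0 => /eqP e; apply: subr0_eq; rewrite -[RHS]e; ring.
Qed.

Lemma beta_mx_neq1 b i j : i != j -> b i j != 0 -> beta_mx b != 1%:M.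
Proof.
move=> ij; apply: contra_neq => /(congr1 (fun A => entry A i j i i)).
rewrite entry_of_entries /entry mxE (can_eq (@mxtens_indexK _ _)) xpair_eqE.
have ji : j != i by rewrite eq_sym.
rewrite eqxx !deltaxx (delta_neq ji) (negbTE ji) /=.
by rewrite !mulr0 !mulr1 !add0r addr0 => /eqP; rewrite oppr_eq0 => /eqP.
Qed.

Section ConstantSum.

Variables (beta : F) (b : 'M[F]_n).
Hypotheses (b_diag : forall i, b i i = 0)
           (b_sum : forall i j, i != j -> b i j + b j i = beta).

Lemma constant_sum_opp i j : i != j -> b j i = beta - b i j.
Proof. by move=> /b_sum <-; rewrite addrAC subrr add0r. Qed.

(** Only the letters i and j intervene, so this is the two-dimensional Hecke
    relation, a polynomial identity once [b j i = beta - b i j]. *)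
Lemma beta_act_hecke w i j :
  beta_act b (beta_act b w) i j = beta * beta_act b w i j + (1 - beta) * w i j.
Proof.
rewrite /beta_act; have [->|ij] := eqVneq i j; first by rewrite !b_diag; ring.
by rewrite (constant_sum_opp ij) !b_diag; ring.
Qed.

Lemma beta_mx_hecke :
  beta_mx b *m beta_mx b = beta *: beta_mx b + (1 - beta)%:M.
Proof.
suff: beta_mx b *m (beta_mx b *m 1%:M)
    = beta *: (beta_mx b *m 1%:M) + (1 - beta) *: 1%:M.
  by rewrite !mulmx1 scalemx1.
apply/matrixP => r c; case: (mxtens_indexP r) => i j.
rewrite [RHS]mxE [X in _ = X + _]mxE [X in _ = _ + X]mxE !mulmx_beta_mx.
by rewrite -beta_act_hecke /beta_act !mulmx_beta_mx.
Qed.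

(** For [beta = 1] the Hecke relation makes the matrix idempotent, hence
    equal to 1 if invertible. *)
Lemma beta_mx_unit i j : i != j -> b i j != 0 ->
  (beta_mx b \in unitmx) = (beta != 1).
Proof.
move=> ij bij; apply/idP/idP => [u|be1].
  apply: contraNneq (beta_mx_neq1 ij bij) => be1; have := beta_mx_hecke.
  rewrite be1 subrr scale1r raddf0 addr0 => /(congr1 (mulmx (invmx (beta_mx b)))).
  by rewrite mulKmx // mulVmx // => ->.
have be1' : 1 - beta != 0 by rewrite subr_eq0 eq_sym.
have : beta_mx b *m ((1 - beta)^-1 *: (beta_mx b - beta%:M)) = 1%:M.
  rewrite -scalemxAr mulmxBr beta_mx_hecke mul_mx_scalar addrAC subrr add0r.
  by rewrite scale_scalar_mx mulVf.
by case/mulmx1_unit.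
Qed.

Lemma beta_mx_nonunitary i j : i != j -> b i j != 0 -> beta != 0 ->
  ~ unitary (beta_mx b).
Proof.
move=> ij bij be0; rewrite /unitary beta_mx_hecke -scalemx1 scalerBl scale1r => e.
have /(scalerI be0) /eqP : beta *: beta_mx b = beta *: 1%:M.
  by apply: (addIr (1%:M - beta *: 1%:M)); rewrite e addrC subrK.
exact/negP/(beta_mx_neq1 ij).
Qed.

End ConstantSum.

(** * The solution attached to homogeneous coordinates *)

Lemma beta_of_diag be phi i : beta_of be phi i i = 0 :> F.
Proof. by rewrite mxE eqxx. Qed.

Section Coordinates.

Variables (beta : F) (phi : 'rV[F]_n).
Hypothesis phi_inj : forall i j, i != j -> phi 0 i != phi 0 j.

Lemma beta_ofE i j : i != j ->
  beta_of beta phi i j = beta * phi 0 i / (phi 0 i - phi 0 j).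
Proof. by move=> ij; rewrite mxE (negbTE ij). Qed.

Lemma beta_of_sum i j : i != j ->
  beta_of beta phi i j + beta_of beta phi j i = beta.
Proof.
move=> ij; have ji : j != i by rewrite eq_sym.
by rewrite !beta_ofE //; field; rewrite !subr_eq0 !phi_inj.
Qed.

(** With a repeated index, the identity is polynomial in a single
    off-diagonal entry of [b]; with distinct indices it is a rational identity in the
    three coordinates, linear in the 27 values of the tensor. *)
Lemma yang_baxter_beta_of : yang_baxter (beta_mx (beta_of beta phi)).
Proof.
apply/yang_baxter_beta_mxP => M i j k /=; move: (fun x y z => M (idx3 x y z) ord0) => w.
set b := beta_of beta phi.
have b0 x : b x x = 0 := beta_of_diag _ _ _.
have bS x y : x != y -> b y x = beta - b x y := constant_sum_opp beta_of_sum (j := y).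
rewrite /beta_act12 /beta_act23 /beta_act.
have [<-{j}|ij] := eqVneq i j; have [<-{k}|ik] := eqVneq i k.
- by rewrite !b0; ring.
- by rewrite (bS _ _ ik) !b0; ring.
- by rewrite (bS _ _ ij) !b0; ring.
have [<-{k ik}|jk] := eqVneq j k; first by rewrite (bS _ _ ij) !b0; ring.
have d x y : x != y -> phi 0 x - phi 0 y != 0.
  by move=> xy; rewrite subr_eq0 phi_inj.
rewrite (bS _ _ ij) (bS _ _ ik) (bS _ _ jk) !b0 /b !beta_ofE //.
(* The tensor values become independent variables, so that the identity is
   between rational functions. *)
move: {w bS b0} (w i i i) (w i i j) (w i i k) (w i j i) (w i j j) (w i j k)
  (w i k i) (w i k j) (w i k k) (w j i i) (w j i j) (w j i k) (w j j i)
  (w j j j) (w j j k) (w j k i) (w j k j) (w j k k) (w k i i) (w k i j)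
  (w k i k) (w k j i) (w k j j) (w k j k) (w k k i) (w k k j) (w k k k) => *.
by field; rewrite !d.
Qed.

End Coordinates.

(** * Rime matrices and their coefficients *)

(** For distinct i and j each of these entries receives a single term, so
    that the coefficients of a rime matrix are unique off the diagonal. *)
Lemma entry_rime_mx (al be ga ga' : 'M[F]_n) i j : i != j ->
  [/\ entry (rime_mx al be ga ga') i j j i = al i j,
      entry (rime_mx al be ga ga') i j i j = be i j
    & entry (rime_mx al be ga ga') i j i i = ga i j].
Proof.
move=> ij; have ji : j != i by rewrite eq_sym.
rewrite !entry_of_entries !deltaxx (delta_neq ij) (delta_neq ji).
by split; rewrite !(mulr0, mulr1, mul0r, add0r, addr0).
Qed.

Lemma rime_rime_mx (al be ga ga' : 'M[F]_n) : rime (rime_mx al be ga ga').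
Proof.
move=> i j k l; rewrite entry_of_entries subUset !sub1set !inE.
rewrite ![_ == i]eq_sym ![_ == j]eq_sym /delta.
case: (i == k); case: (i == l); case: (j == k); case: (j == l) => //=;
  by rewrite !(mulr0, mulr1, mul0r, add0r, addr0) eqxx.
Qed.

Lemma beta_mxE b :
  beta_mx b = rime_mx (\matrix_(i, j) (1 - b j i)) b (- b) b^T.
Proof.
apply: entry_inj => i j k l; rewrite !entry_of_entries !mxE; ring.
Qed.

Lemma entry_beta_mx b i j : i != j -> entry (beta_mx b) i j i j = b i j.
Proof.
move=> ij; rewrite beta_mxE.
by have [] := entry_rime_mx (\matrix_(i, j) (1 - b j i)) b (- b) b^T ij.
Qed.

Lemma strict_rime_beta_mx b : (forall i, b i i = 0) ->
  strict_rime (beta_mx b) <->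
  forall i j, i != j -> (b i j != 0) && (1 - b j i != 0).
Proof.
move=> b0; split=> [[_ [al [be [ga [ga' [_ e ne0]]]]]] i j ij|ne0].
  have [al1 _ ga1] := entry_rime_mx al be ga ga' ij.
  have [al2 _ ga2] := entry_rime_mx (\matrix_(i, j) (1 - b j i)) b (- b) b^T ij.
  move: (ne0 i j ij); rewrite -al1 -ga1 -e beta_mxE al2 ga2 !mxE.
  by rewrite mulf_eq0 negb_or oppr_eq0 andbC.
split; first by rewrite beta_mxE; apply: rime_rime_mx.
exists (\matrix_(i, j) (1 - b j i)), b, (- b), b^T.
split=> [i||i j ij]; first by rewrite !mxE b0 oppr0.
  exact: beta_mxE.
by rewrite !mxE mulf_eq0 negb_or oppr_eq0 andbC ne0.
Qed.

End Tensors.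

(** * Homogeneous coordinates of a projective point *)

Section ProjectiveSpace.

Variables (F : fieldType) (n : nat).
Implicit Types (P Q : proj_space F n) (phi psi : 'rV[F]_n).

Lemma coords_exist P : exists phi, homogeneous_coords P phi.
Proof.
exists (vpick (sval P)); split; last exact: memv_pick.
by rewrite vpick0 -dimv_eq0 (eqP (svalP P)).
Qed.

Lemma point_of_coords phi : phi != 0 -> exists P, homogeneous_coords P phi.
Proof.
move=> phi0; have d1 : \dim <[phi]>%VS == 1%N by rewrite dim_vline phi0.
by exists (exist _ <[phi]>%VS d1); split=> //=; apply: memv_line.
Qed.

Lemma coords_line P phi : homogeneous_coords P phi -> sval P = <[phi]>%VS.
Proof.
case=> phi0 Pphi; apply/esym/eqP; rewrite eqEdim -memvE Pphi.
by rewrite (eqP (svalP P)) dim_vline phi0.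
Qed.

Lemma coords_unique P phi psi :
  homogeneous_coords P phi -> homogeneous_coords P psi ->
  exists2 c, c != 0 & psi = c *: phi.
Proof.
move=> /coords_line Pphi [psi0]; rewrite Pphi => /vlineP [c e].
by exists c => //; apply: contraNneq psi0 => c0; rewrite e c0 scale0r.
Qed.

Lemma point_of_coords_unique P Q phi c : c != 0 ->
  homogeneous_coords P phi -> homogeneous_coords Q (c *: phi) -> P = Q.
Proof.
move=> c0 /coords_line Pphi /coords_line Qphi; apply: val_inj => /=.
rewrite Pphi Qphi; apply/eqP; rewrite eqEdim !dim_vline scaler_eq0 negb_or c0.
rewrite leqnn andbT -memvE; apply/vlineP; exists c^-1.
by rewrite scalerA mulVf ?scale1r.
Qed.

Definition distinct_nonzero phi :=
  (forall i, phi 0 i != 0) /\ (forall i j, i != j -> phi 0 i != phi 0 j).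

(** The notions required of every system of coordinates of a point are scale
    invariant, hence can be checked on one: this lemma and the next ones. *)
Lemma admissible_coords P phi :
  homogeneous_coords P phi -> admissible P <-> distinct_nonzero phi.
Proof.
move=> Pphi; split=> [|[nz inj] psi Ppsi]; first exact.
have [c c0 ->] := coords_unique Pphi Ppsi.
split=> [i|i j ij]; rewrite !mxE; first by rewrite mulf_neq0.
by rewrite (inj_eq (mulfI c0)) inj.
Qed.

Lemma beta_of_scale beta phi c : c != 0 ->
  beta_of beta (c *: phi) = beta_of beta phi.
Proof.
move=> c0; apply/matrixP => i j; rewrite !mxE; case: eqP => // _.
by rewrite -mulrBr mulrCA -mulf_div divff // mul1r.
Qed.

Lemma given_by_coords beta P phi Rh : homogeneous_coords P phi ->
  given_by beta P Rh <-> Rh = beta_mx (beta_of beta phi).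
Proof.
move=> Pphi; split=> [|-> psi Ppsi]; first exact.
by have [c c0 ->] := coords_unique Pphi Ppsi; rewrite beta_of_scale.
Qed.

Lemma nonvanishing_alpha_coords beta P phi : homogeneous_coords P phi ->
  nonvanishing_alpha beta P <->
  forall i j, i != j -> phi 0 i != (1 - beta) * phi 0 j.
Proof.
move=> Pphi; split=> [|ne psi Ppsi i j ij]; first exact.
have [c c0 ->] := coords_unique Pphi Ppsi.
by rewrite !mxE mulrCA (inj_eq (mulfI c0)) ne.
Qed.

(** Cross-multiplying the equal values of [b i0 j] gives
    [phi i0 * psi j = psi i0 * phi j]. *)
Lemma beta_of_inj beta phi psi (i0 : 'I_n) : beta != 0 ->
  distinct_nonzero phi -> distinct_nonzero psi -> beta_of beta phi = beta_of beta psi ->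
  exists2 c, c != 0 & psi = c *: phi.
Proof.
move=> be0 [phi0 phi_inj] [psi0 psi_inj] e.
exists (psi 0 i0 / phi 0 i0); first by rewrite mulf_neq0 ?invr_eq0.
apply/rowP => j; rewrite mxE; have [->|ij] := eqVneq i0 j; first by rewrite divfK.
have := congr1 (fun b : 'M_n => b i0 j) e; rewrite !beta_ofE // => /eqP.
rewrite -!mulrA (inj_eq (mulfI be0)) eqr_div ?subr_eq0 ?phi_inj ?psi_inj //.
move=> /eqP e'; apply: (mulfI (phi0 i0)).
transitivity (psi 0 i0 * phi 0 j); last by field; rewrite phi0.
apply: oppr_inj; apply: (addrI (phi 0 i0 * psi 0 i0)).
by rewrite -mulrBr e'; ring.
Qed.

End ProjectiveSpace.

(** * Recovering the coordinates from the parameters *)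

(** The vector is normalized by [phi i0 = 1]; the [i0]-entries of [b] then
    dictate its other coordinates, and the relation for triples (i, j, i0)
    propagates the formula to all entries. *)
Lemma coords_of_relation (F : fieldType) (n : nat) (beta : F) (b : 'M[F]_n)
    (i0 : 'I_n) :
  beta != 0 ->
  (forall i, b i i = 0) ->
  (forall i j, i != j -> b i j + b j i = beta) ->
  (forall i j, i != j -> b i j != 0) ->
  (forall i j k, i != j -> i != k -> j != k ->
     b i j * b j k = (b j k - b j i) * b i k) ->
  exists phi, distinct_nonzero phi /\ b = beta_of beta phi.
Proof.
move=> be0 b_diag b_sum b_neq0 b_rel.
pose phi := \row_i (if i == i0 then 1 else - b i i0 / b i0 i).
have phi_i0 : phi 0 i0 = 1 by rewrite mxE eqxx.
have phiE i : i != i0 -> phi 0 i = - b i i0 / b i0 i.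
  by rewrite mxE => /negbTE ->.
have phi_neq0 i : phi 0 i != 0.
  have [->|ii0] := eqVneq i i0; first by rewrite phi_i0 oner_eq0.
  by rewrite phiE // mulf_neq0 ?invr_eq0 ?oppr_eq0 ?b_neq0 // eq_sym.
(* The ratio of the coordinates is the one read off from [b]. *)
have bal i j : i != j -> b j i * phi 0 i = - (b i j * phi 0 j).
  have bal0 k : k != i0 -> b i0 k * phi 0 k = - b k i0.
    by move=> ki0; rewrite phiE // mulrC divfK // b_neq0 // eq_sym.
  move=> ij; have [ii0|ii0] := eqVneq i i0.
    by rewrite ii0 phi_i0 mulr1 bal0 ?opprK // -ii0 eq_sym.
  have [ji0|ji0] := eqVneq j i0.
    by rewrite ji0 phi_i0 mulr1 bal0.
  have [i0i i0j] : i0 != i /\ i0 != j by rewrite !(eq_sym i0).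
  rewrite !phiE //.
  have cyc : b i j * b j i0 * b i0 i + b j i * b i i0 * b i0 j = 0.
    have := b_rel i j i0 ij ii0 ji0.
    rewrite (constant_sum_opp b_sum ij) (constant_sum_opp b_sum ii0) (constant_sum_opp b_sum ji0) => rel.
    transitivity (beta * (b i j * b j i0 -
                          (b j i0 - (beta - b i j)) * b i i0)); first by ring.
    by rewrite rel subrr mulr0.
  apply: subr0_eq.
  (* Clearing denominators leaves the cyclic identity. *)
  transitivity (- (b i j * b j i0 * b i0 i + b j i * b i i0 * b i0 j)
                / (b i0 i * b i0 j)); first by field; rewrite !b_neq0.
  by rewrite cyc oppr0 mul0r.
have lin i j : i != j -> b i j * (phi 0 i - phi 0 j) = beta * phi 0 i.
  move=> ij; rewrite mulrBr; have := bal _ _ ij.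
  by rewrite -(b_sum _ _ ij) mulrDl => ->.
have phi_inj i j : i != j -> phi 0 i != phi 0 j.
  move=> ij; rewrite -subr_eq0; apply: contraTneq (mulf_neq0 be0 (phi_neq0 i)).
  by rewrite -(lin _ _ ij) => ->; rewrite mulr0 eqxx.
exists phi; split=> //; apply/matrixP => i j.
have [->|ij] := eqVneq i j; first by rewrite b_diag beta_of_diag.
by rewrite beta_ofE // -(lin _ _ ij) mulfK // subr_eq0 phi_inj.
Qed.

(** * The classification over a field *)

Section Classification.

Variables (F : fieldType) (n : nat) (beta : F).
Hypotheses (n_gt1 : (1 < n)%N) (beta_neq0 : beta != 0).
Implicit Types (P : proj_space F n) (phi psi : 'rV[F]_n) (Rh : 'M[F]_(n * n)).

Let i0 : 'I_n := Ordinal (ltnW n_gt1).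
Let i1 : 'I_n := Ordinal n_gt1.

Lemma coords_of_solution Rh : nonunitary_strict_rime_solution beta Rh ->
  exists phi, distinct_nonzero phi /\ Rh = beta_mx (beta_of beta phi).
Proof.
case=> _ [b [b_diag b_sum ->]] _ /(strict_rime_beta_mx b_diag) ne0 yb.
have b_neq0 i j : i != j -> b i j != 0 by move=> /ne0 /andP[].
have b_rel i j k : i != j -> i != k -> j != k ->
    b i j * b j k = (b j k - b j i) * b i k.
  by move=> ij ik jk; apply: braid_relation => //; case/andP: (ne0 i j ij).
have [phi [gphi ->]] := coords_of_relation i0 beta_neq0 b_diag b_sum b_neq0 b_rel.
by exists phi.
Qed.

Lemma beta_mx_beta_of_inj phi psi : distinct_nonzero phi -> distinct_nonzero psi ->
  beta_mx (beta_of beta phi) = beta_mx (beta_of beta psi) ->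
  exists2 c, c != 0 & psi = c *: phi.
Proof.
move=> gphi gpsi e; apply: (beta_of_inj i0 beta_neq0 gphi gpsi).
apply/matrixP => i j; have [->|ij] := eqVneq i j; first by rewrite !beta_of_diag.
by rewrite -!(entry_beta_mx _ ij) e.
Qed.

Lemma point_of_solution Rh : nonunitary_strict_rime_solution beta Rh ->
  exists! P : proj_space F n, admissible P /\ given_by beta P Rh.
Proof.
case/coords_of_solution => phi [gphi RhE].
have phi0 : phi != 0 by apply: contraNneq (gphi.1 i0) => ->; rewrite mxE.
have [P Pphi] := point_of_coords phi0; exists P; split.
  by split; [apply/(admissible_coords Pphi)|apply/(given_by_coords _ _ Pphi)].
move=> Q [Qadm Qgiv]; have [psi Qpsi] := coords_exist Q.
have gpsi := Qadm _ Qpsi; have RhE' := Qgiv _ Qpsi.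
have [c c0 psiE] := beta_mx_beta_of_inj gphi gpsi (etrans (esym RhE) RhE').
by apply: (point_of_coords_unique c0 Pphi); rewrite -psiE.
Qed.

Lemma matrix_of_point P : exists! Rh : 'M[F]_(n * n), given_by beta P Rh.
Proof.
have [phi Pphi] := coords_exist P.
exists (beta_mx (beta_of beta phi)); split; first exact/(given_by_coords _ _ Pphi).
by move=> Rh /(given_by_coords _ _ Pphi).
Qed.

(** Since [1 - b j i = (phi i - (1 - beta) * phi j) / (phi i - phi j)]. *)
Lemma alpha_neq0E phi i j : distinct_nonzero phi -> i != j ->
  (1 - beta_of beta phi j i != 0) = (phi 0 i != (1 - beta) * phi 0 j).
Proof.
move=> [_ inj] ij; have ji : j != i by rewrite eq_sym.
have d : phi 0 j - phi 0 i != 0 by rewrite subr_eq0 inj.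
rewrite -(inj_eq (mulIf d)) mul0r mulrBl mul1r beta_ofE // divfK //.
rewrite addrAC subr_eq0 mulrBl mul1r subr_eq [in RHS]eq_sym.
by rewrite [in RHS]subr_eq.
Qed.

Lemma solution_of_point P Rh : admissible P -> given_by beta P Rh ->
  [/\ yang_baxter Rh /\ beta_form beta Rh,
      ~ unitary Rh,
      Rh \in unitmx <-> beta != 1,
      strict_rime Rh <-> nonvanishing_alpha beta P
    & nonunitary_strict_rime_solution beta Rh <->
        beta != 1 /\ nonvanishing_alpha beta P].
Proof.
have [phi Pphi] := coords_exist P.
move=> Padm /(given_by_coords _ _ Pphi) ->; have gphi := Padm _ Pphi.
have [phi0 phi_inj] := gphi; set b := beta_of beta phi.
have b_diag i : b i i = 0 by apply: beta_of_diag.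
have b_sum i j : i != j -> b i j + b j i = beta by apply: beta_of_sum.
have b_neq0 i j : i != j -> b i j != 0.
  move=> ij; rewrite /b beta_ofE // !mulf_neq0 ?invr_eq0 ?subr_eq0 //.
  exact: phi_inj.
have i01 : i0 != i1 by [].
have b01 := b_neq0 _ _ i01.
have yb : yang_baxter (beta_mx b) by apply: yang_baxter_beta_of.
have form : beta_form beta (beta_mx b) by exists b.
have nonun := beta_mx_nonunitary b_diag b_sum i01 b01 beta_neq0.
have unit : beta_mx b \in unitmx <-> beta != 1.
  by rewrite (beta_mx_unit b_diag b_sum i01 b01).
have strict : strict_rime (beta_mx b) <-> nonvanishing_alpha beta P.
  split=> [/(strict_rime_beta_mx b_diag) ne0|/(nonvanishing_alpha_coords _ Pphi) ne].
    apply/(nonvanishing_alpha_coords _ Pphi) => i j ij.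
    by rewrite -alpha_neq0E //; case/andP: (ne0 i j ij).
  apply/(strict_rime_beta_mx b_diag) => i j ij.
  by rewrite b_neq0 //= alpha_neq0E // ne.
split=> //; split=> [[u _ _ s _]|[u s]].
  by split; [apply/unit|apply/strict].
by split=> //; [apply/unit|apply/strict].
Qed.

End Classification.

Theorem proposition2 (R : realType) (n : nat) (hn : (1 < n)%N)
    (beta : R[i]) (hbeta : beta != 0) :
  (forall Rh : 'M[R[i]]_(n * n),
     nonunitary_strict_rime_solution beta Rh ->
     exists! P : proj_space R[i] n, admissible P /\ given_by beta P Rh)
  /\
  (forall P : proj_space R[i] n, admissible P ->
     exists! Rh : 'M[R[i]]_(n * n), given_by beta P Rh)
  /\
  (forall (P : proj_space R[i] n) (Rh : 'M[R[i]]_(n * n)),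
     admissible P -> given_by beta P Rh ->
     [/\ yang_baxter Rh /\ beta_form beta Rh,
         ~ unitary Rh,
         Rh \in unitmx <-> beta != 1,
         strict_rime Rh <-> nonvanishing_alpha beta P
       & nonunitary_strict_rime_solution beta Rh <->
           beta != 1 /\ nonvanishing_alpha beta P]).
Proof.
split; first exact: point_of_solution.
split=> [P _|]; first exact: matrix_of_point.
exact: solution_of_point.
Qed.
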